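(* For a variety $\mathcal V$ of residuated lattices, the following statements are equivalent: (1) $\mathcal V$ is semilinear. (2) $\mathcal V$ satisfies at least one of the equations $$\lambda_u((x\vee y)\backslash x)\vee\rho_v((x\vee y)\backslash y)\approx \mathrm e,\qquad \lambda_u(x/(x\vee y))\vee\rho_v(y/(x\vee y))\approx \mathrm e .$$ (3) $\mathcal V$ satisfies at least one of the two prelinearity laws, and the quasi-identity $$x\vee y\approx \mathrm e\ \Rightarrow\ \lambda_u(x)\vee\rho_v(y)\approx \mathrm e .$$ If in addition $\mathcal V$ is a variety of $\mathrm e$-cyclic residuated lattices and satisfies at least one of the two prelinearity laws, the preceding conditions are equivalent to each of the conditions below: (4) For every $\mathbf L\in\mathcal V$, all polars in $\mathbf L$ are normal. (4') For every $\mathbf L\in\mathcal V$, all principal polars in $\mathbf L$ are normal. (5) For every $\mathbf L\in\mathcal V$, all minimal prime convex subalgebras of $\mathbf L$ are normal.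
   Context: A residuated lattice is an algebra $\mathbf L=(L,\cdot,\backslash,/,\vee,\wedge,\mathrm e)$ such that $(L,\cdot,\mathrm e)$ is a monoid, $(L,\vee,\wedge)$ is a lattice with order $\le$, and $x\cdot y\le z \iff y\le x\backslash z \iff x\le z/y$ for all $x,y,z\in L$. It is $\mathrm e$-cyclic if $\mathrm e/x=x\backslash \mathrm e$ for all $x\in L$. The absolute value of $x$ is $|x|=x\wedge(\mathrm e/x)\wedge \mathrm e$. Left conjugation and right conjugation by $u$ are $\lambda_u(x)=(u\backslash xu)\wedge \mathrm e$ and $\rho_u(x)=(ux/u)\wedge \mathrm e$. The left prelinearity law is $((x\backslash y)\wedge \mathrm e)\vee((y\backslash x)\wedge \mathrm e)\approx \mathrm e$; the right prelinearity law is $((y/x)\wedge \mathrm e)\vee((x/y)\wedge \mathrm e)\approx \mathrm e$. A variety of residuated lattices is semilinear if it is generated by its linearly ordered members; equivalently, each of its members is a subdirect product of totally ordered residuated lattices. A convex subalgebra of $\mathbf L$ is a subalgebra (closed under all operations, containing $\mathrm e$) whose universe is order-convex; it is prime if whenever $X,Y$ are convex subalgebras with $X\cap Y\subseteq H$, then $X\subseteq H$ or $Y\subseteq H$; minimal prime means minimal under inclusion among the prime ones. A convex subalgebra $H$ is normal if $(y\backslash xy)\wedge \mathrm e\in H$ and $(yx/y)\wedge \mathrm e\in H$ for all $x\in H$, $y\in L$. For $\mathrm e$-cyclic $\mathbf L$ and non-empty $X\subseteq L$, the polar of $X$ is $X^\perp=\{a\in L:|a|\vee|x|=\mathrm e\text{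 for all }x\in X\}$, which is a convex subalgebra; principal polars are the sets $x^\perp=\{x\}^\perp$, $x\in L$. *)

(* Defs.v *)
From HB Require Import structures.
From mathcomp Require Import all_boot all_order.
From mathcomp Require Import boolp classical_sets.

Set Implicit Arguments.
Unset Strict Implicit.
Unset Printing Implicit Defensive.

Import Order.TTheory.

Local Open Scope group_scope.
Local Open Scope classical_set_scope.
Local Open Scope order_scope.

(* [choiceType] structures, implied by [Order.Lattice] and [Monoid], exist on
   every type in the presence of the classical axioms of [boolp]. *)
HB.mixin Record LatticeMonoid_isResiduated (d : Order.disp_t) (L : Type)
    of Order.Lattice d L & Monoid L := {
  ldiv : L -> L -> L;
  rdiv : L -> L -> L;
  ldivP : forall x y z : L, (x * y <= z) = (y <= ldiv x z);
  rdivP : forall x y z : L, (x * y <= z) = (x <= rdiv z y)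
}.

#[short(type="residuatedLatticeType")]
HB.structure Definition ResiduatedLattice (d : Order.disp_t) :=
  {L of LatticeMonoid_isResiduated d L & Order.Lattice d L & Monoid L}.

Declare Scope reslat_scope.
Delimit Scope reslat_scope with RL.
Notation "x \ z" := (ldiv x z) (at level 50) : reslat_scope.
Notation "z / y" := (rdiv z y) : reslat_scope.
Local Open Scope reslat_scope.

Section Varieties.
Context {d : Order.disp_t}.
Implicit Types L M : residuatedLatticeType d.

Record rl_morphism L M (f : L -> M) : Prop := RLMorphism {
  rl_morph1 : f 1 = 1;
  rl_morphM : {morph f : x y / x * y};
  rl_morph_ldiv : {morph f : x y / x \ y};
  rl_morph_rdiv : {morph f : x y / x / y};
  rl_morphU : {morph f : x y / x `|` y};
  rl_morphI : {morph f : x y / x `&` y}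
}.

Definition rl_prod (I : Type) (A : I -> residuatedLatticeType d) : Type :=
  forall i, A i.

Section Product.
Variables (I : Type) (A : I -> residuatedLatticeType d).
Implicit Types x y z : rl_prod A.

HB.instance Definition _ := Choice.copy (rl_prod A) (forall i, A i).

Definition rlp_le x y : bool := `[< forall i, x i <= y i >].

Fact rlp_le_refl : reflexive rlp_le.
Proof. by move=> x; apply/asboolP => i. Qed.

Fact rlp_le_anti : antisymmetric rlp_le.
Proof.
move=> x y /andP[/asboolP xy /asboolP yx]; apply: functional_extensionality_dep.
by move=> i; apply: le_anti; rewrite xy yx.
Qed.

Fact rlp_le_trans : transitive rlp_le.
Proof.
move=> y x z /asboolP xy /asboolP yz; apply/asboolP => i.
exact: le_trans (xy i) (yz i).
Qed.

HB.instance Definition _ := Order.Le_isPOrder.Build d (rl_prod A)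
  rlp_le_refl rlp_le_anti rlp_le_trans.

Fact rlp_leE x y : (x <= y) = `[< forall i, x i <= y i >].
Proof. by []. Qed.

Definition rlp_meet x y : rl_prod A := fun i => x i `&` y i.
Definition rlp_join x y : rl_prod A := fun i => x i `|` y i.

Fact rlp_meetP x y z : (x <= rlp_meet y z) = (x <= y) && (x <= z).
Proof.
rewrite !rlp_leE; apply/asboolP/andP => [h|[/asboolP xy /asboolP xz] i].
  by split; apply/asboolP => i; move: (h i); rewrite lexI => /andP[].
by rewrite lexI xy xz.
Qed.

Fact rlp_joinP x y z : (rlp_join x y <= z) = (x <= z) && (y <= z).
Proof.
rewrite !rlp_leE; apply/asboolP/andP => [h|[/asboolP xz /asboolP yz] i].
  by split; apply/asboolP => i; move: (h i); rewrite leUx => /andP[].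
by rewrite leUx xz yz.
Qed.

HB.instance Definition _ := Order.POrder_MeetJoin_isLattice.Build d (rl_prod A)
  rlp_meetP rlp_joinP.

Definition rlp_one : rl_prod A := fun=> 1.
Definition rlp_mul x y : rl_prod A := fun i => x i * y i.

Fact rlp_mulA : associative rlp_mul.
Proof.
by move=> x y z; apply: functional_extensionality_dep => i; apply: mulgA.
Qed.

Fact rlp_mul1 : left_id rlp_one rlp_mul.
Proof. by move=> x; apply: functional_extensionality_dep => i; apply: mul1g. Qed.

Fact rlp_1mul : right_id rlp_one rlp_mul.
Proof. by move=> x; apply: functional_extensionality_dep => i; apply: mulg1. Qed.

HB.instance Definition _ := isMonoid.Build (rl_prod A)
  rlp_mulA rlp_mul1 rlp_1mul.

Definition rlp_ldiv x z : rl_prod A := fun i => x i \ z i.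
Definition rlp_rdiv z y : rl_prod A := fun i => z i / y i.

Fact rlp_ldivP x y z : (x * y <= z) = (y <= rlp_ldiv x z).
Proof.
by rewrite !rlp_leE; apply/asboolP/asboolP => h i; move: (h i); rewrite ldivP.
Qed.

Fact rlp_rdivP x y z : (x * y <= z) = (x <= rlp_rdiv z y).
Proof.
by rewrite !rlp_leE; apply/asboolP/asboolP => h i; move: (h i); rewrite rdivP.
Qed.

HB.instance Definition _ := LatticeMonoid_isResiduated.Build d (rl_prod A)
  rlp_ldivP rlp_rdivP.

End Product.

(* Closure under subalgebras is stated with embeddings and closure under
   homomorphic images with surjections, so a variety is closed under
   isomorphism. *)
Record variety (V : residuatedLatticeType d -> Prop) : Prop := Variety {
  variety_sub : forall L M (f : M -> L),
    rl_morphism f -> injective f -> V L -> V M;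
  variety_img : forall L M (f : L -> M),
    rl_morphism f -> (forall y, exists x, f x = y) -> V L -> V M;
  variety_prod : forall (I : Type) (A : I -> residuatedLatticeType d),
    (forall i, V (A i)) -> V (rl_prod A)
}.

Definition generated_variety (K : residuatedLatticeType d -> Prop) L : Prop :=
  forall W, variety W -> (forall M, K M -> W M) -> W L.

Definition linearly_ordered L : Prop := total (<=%O : rel L).

Definition semilinear (V : residuatedLatticeType d -> Prop) : Prop :=
  forall L, V L <-> generated_variety (fun M => V M /\ linearly_ordered M) L.

Definition satisfies (V P : residuatedLatticeType d -> Prop) : Prop :=
  forall L, V L -> P L.

End Varieties.

Section Laws.
Context {d : Order.disp_t}.
Variable L : residuatedLatticeType d.
Implicit Types x y u v : L.

Definition lconj u x : L := (u \ (x * u)) `&` 1.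
Definition rconj u x : L := ((u * x) / u) `&` 1.

Definition left_prelinear : Prop :=
  forall x y, ((x \ y) `&` 1) `|` ((y \ x) `&` 1) = 1.

Definition right_prelinear : Prop :=
  forall x y, ((y / x) `&` 1) `|` ((x / y) `&` 1) = 1.

Definition left_conj_law : Prop := forall x y u v,
  lconj u ((x `|` y) \ x) `|` rconj v ((x `|` y) \ y) = 1.

Definition right_conj_law : Prop := forall x y u v,
  lconj u (x / (x `|` y)) `|` rconj v (y / (x `|` y)) = 1.

Definition conj_quasi_law : Prop := forall x y u v,
  x `|` y = 1 -> lconj u x `|` rconj v y = 1.

Definition e_cyclic : Prop := forall x, 1 / x = x \ 1.

End Laws.

Section ConvexSubalgebras.
Context {d : Order.disp_t} {L : residuatedLatticeType d}.
Implicit Types (x y z a : L) (H X Y : set L).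

Record convex_subalgebra H : Prop := ConvexSubalgebra {
  csub1 : H 1;
  csubM : forall x y, H x -> H y -> H (x * y);
  csub_ldiv : forall x y, H x -> H y -> H (x \ y);
  csub_rdiv : forall x y, H x -> H y -> H (x / y);
  csubU : forall x y, H x -> H y -> H (x `|` y);
  csubI : forall x y, H x -> H y -> H (x `&` y);
  csub_convex : forall x y z, H x -> H z -> x <= y -> y <= z -> H y
}.

(* The whole algebra counts as prime. *)
Definition prime_convex_subalgebra H : Prop :=
  convex_subalgebra H /\
  forall X Y, convex_subalgebra X -> convex_subalgebra Y ->
    (X `&` Y `<=` H)%classic -> (X `<=` H)%classic \/ (Y `<=` H)%classic.

Definition minimal_prime H : Prop :=
  prime_convex_subalgebra H /\
  forall X, prime_convex_subalgebra X ->
    (X `<=` H)%classic -> (H `<=` X)%classic.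

(* A property of convex subalgebras [H]. *)
Definition normal H : Prop :=
  forall x y, H x -> H (lconj y x) /\ H (rconj y x).

Definition absval x : L := x `&` (1 / x) `&` 1.

Definition polar X : set L :=
  [set a | forall x, X x -> absval a `|` absval x = 1].

Definition principal_polar x : set L := polar [set x]%classic.

End ConvexSubalgebras.

Section Conditions.
Context {d : Order.disp_t}.
Variable L : residuatedLatticeType d.

Definition polars_normal : Prop :=
  forall X : set L, X !=set0 -> normal (polar X).

Definition principal_polars_normal : Prop :=
  forall x : L, normal (principal_polar x).

Definition minimal_primes_normal : Prop :=
  forall H : set L, minimal_prime H -> normal H.

End Conditions.

(* Main.v *)
(** A filter of the negative cone [{x | x <= 1}] is an upward closed submonoid
    of it, and a filter is prime when it contains one of [x], [y] as soon as it
    contains [x `|` y].  If [x `|` y = 1] then a prime filter contains [x] or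
    [y]; conversely, by minimality, every member [a] of a minimal prime filter
    [F] other than the whole cone satisfies [a `|` x = 1] for some [x] outside
    [F].  Hence the quasi-identity, or the normality of principal polars, makes
    minimal prime filters normal.  The quotient by a normal prime filter is a
    chain by prelinearity, and the minimal prime filters separate points, so
    the algebra embeds into a product of chains of the variety.  In the
    [e]-cyclic case, convex subalgebras correspond to filters of the negative
    cone through [H |-> H^-] and [F |-> {z | |z| \in F}]. *)
Require Import Defs.
From HB Require Import structures.
From mathcomp Require Import all_boot all_order.
From mathcomp Require Import boolp classical_sets.
From mathcomp Require Import generic_quotient.

Set Implicit Arguments.
Unset Strict Implicit.
Unset Printing Implicit Defensive.

Import Order.TTheory.

Local Open Scope group_scope.
Local Open Scope classical_set_scope.
Local Open Scope quotient_scope.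
Local Open Scope order_scope.
Local Open Scope reslat_scope.

(** [Zorn_bigcup] is applied to the sets [X] whose union with [A0] is in [P]: the empty chain is
    then covered by [P A0], and the maximal set found contains [A0]. *)
Lemma Zorn_bigcup_above (T : Type) (P : set (set T)) (A0 : set T) :
    P A0 ->
    (forall F : set (set T), F !=set0 -> F `<=` P -> total_on F subset ->
      P (\bigcup_(X in F) X)) ->
  exists A, [/\ P A, (A0 `<=` A)%classic &
    forall B, P B -> (A `<=` B)%classic -> (B `<=` A)%classic].
Proof.
move=> PA0 PU.
have [F FP Ftot|A [PA Amax]] := @Zorn_bigcup T [set X | P (A0 `|` X)%classic].
  rewrite /=; have [->|/set0P [X0 FX0]] := eqVneq F set0.
    by rewrite bigcup_set0 setU0.
  have -> : (A0 `|` \bigcup_(X in F) X =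
      \bigcup_(Y in [set (A0 `|` X)%classic | X in F]) Y)%classic.
    rewrite bigcup_image; apply/seteqP; split=> x.
      by case=> [A0x|[X FX Xx]]; [exists X0 => //; left|exists X => //; right].
    by case=> X FX [A0x|Xx]; [left|right; exists X].
  apply: PU; first by exists (A0 `|` X0)%classic; exists X0.
    by move=> _ [X FX <-]; apply: FP.
  move=> _ _ [X FX <-] [Y FY <-].
  by case: (Ftot _ _ FX FY) => XY; [left|right]; apply: setUS.
exists (A0 `|` A)%classic; split=> // B PB AB.
have [BA|nBA] := pselect (B `<=` A)%classic; first by move=> x /BA; right.
case: (Amax B); last first.
  rewrite /= (_ : (A0 `|` B)%classic = B) //.
  by apply: setUidr => x ?; apply: AB; left.
by split=> // x Ax; apply: AB; right.
Qed.

(** * Order arithmetic of products, residuals, conjugates and absolute values *)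

Section Basics.
Context {d : Order.disp_t} {L : residuatedLatticeType d}.
Implicit Types (x y z w u v f g : L).

Lemma le_mul x y z w : x <= y -> z <= w -> x * z <= y * w.
Proof.
move=> xy zw; apply: (@le_trans _ _ (y * z)).
  by rewrite rdivP; apply: le_trans xy _; rewrite -rdivP.
by rewrite ldivP; apply: le_trans zw _; rewrite -ldivP.
Qed.

Lemma mulUx_le x y z w : ((x `|` y) * z <= w) = (x * z <= w) && (y * z <= w).
Proof. by rewrite rdivP leUx -!rdivP. Qed.

Lemma mulxU_le x y z w : (z * (x `|` y) <= w) = (z * x <= w) && (z * y <= w).
Proof. by rewrite ldivP leUx -!ldivP. Qed.

Lemma mul_ldiv_le x y : x * (x \ y) <= y.
Proof. by rewrite ldivP. Qed.

Lemma mul_rdiv_le x y : (x / y)%RL * y <= x.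
Proof. by rewrite rdivP. Qed.

Lemma one_le_ldiv x y : (1 <= x \ y) = (x <= y).
Proof. by rewrite -ldivP mulg1. Qed.

Lemma ldiv1x x : 1 \ x = x.
Proof.
apply/le_anti/andP; split; last by rewrite -ldivP mul1g.
by have := mul_ldiv_le 1 x; rewrite mul1g.
Qed.

Lemma rdivx1 x : x / 1 = x.
Proof.
apply/le_anti/andP; split; last by rewrite -rdivP mulg1.
by have := mul_rdiv_le x 1; rewrite mulg1.
Qed.

Lemma mul_le1 x y : x <= 1 -> y <= 1 -> x * y <= 1.
Proof. by move=> x1 y1; rewrite -[leRHS]mulg1 le_mul. Qed.

Lemma mul_lel x y : y <= 1 -> x * y <= x.
Proof. by move=> y1; rewrite -[leRHS]mulg1 le_mul. Qed.

Lemma mul_ler x y : x <= 1 -> x * y <= y.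
Proof. by move=> x1; rewrite -[leRHS]mul1g le_mul. Qed.

(** Of the four products after distributing, three have [a] as a factor and the other factor at most
    [1], so they lie below [a]. This makes [residual] closed under products. *)
Lemma mul_join_le (a b b' : L) : a <= 1 -> b <= 1 -> b' <= 1 ->
  (b `|` a) * (b' `|` a) <= (b * b') `|` a.
Proof.
move=> a1 b1 b'1; rewrite mulUx_le !mulxU_le leUl /=.
by rewrite !lexUr ?mul_lel ?mul_ler.
Qed.

Lemma lconj1 x : lconj 1 x = x `&` 1.
Proof. by rewrite /lconj mulg1 ldiv1x. Qed.

Lemma rconj1 x : rconj 1 x = x `&` 1.
Proof. by rewrite /rconj mul1g rdivx1. Qed.

Lemma lconj_le1 u x : lconj u x <= 1.
Proof. exact: leIr. Qed.

Lemma rconj_le1 u x : rconj u x <= 1.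
Proof. exact: leIr. Qed.

Lemma lconj_mono u x y : x <= y -> lconj u x <= lconj u y.
Proof.
move=> xy; rewrite lexI leIr andbT leIxl // -ldivP.
exact: le_trans (mul_ldiv_le _ _) (le_mul _ _).
Qed.

Lemma rconj_mono u x y : x <= y -> rconj u x <= rconj u y.
Proof.
move=> xy; rewrite lexI leIr andbT leIxl // -rdivP.
exact: le_trans (mul_rdiv_le _ _) (le_mul _ _).
Qed.

Lemma mul_lconj_le u x : u * lconj u x <= x * u.
Proof. by rewrite ldivP leIl. Qed.

Lemma mul_rconj_le u x : rconj u x * u <= u * x.
Proof. by rewrite rdivP leIl. Qed.

Lemma lconj_eq1 u x : 1 <= x -> lconj u x = 1.
Proof.
move=> x1; apply/le_anti; rewrite leIr lexI lexx -ldivP mulg1.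
by rewrite -[leLHS]mul1g le_mul.
Qed.

Lemma rconj_eq1 u x : 1 <= x -> rconj u x = 1.
Proof.
move=> x1; apply/le_anti; rewrite leIr lexI lexx -rdivP mul1g.
by rewrite -[leLHS]mulg1 le_mul.
Qed.

Lemma ldivU_le x y z : (x `|` y) \ z <= y \ z.
Proof.
by rewrite -ldivP; apply: le_trans (mul_ldiv_le (x `|` y) z); rewrite le_mul ?leUr.
Qed.

Lemma rdivU_le x y z : z / (x `|` y) <= z / y.
Proof.
by rewrite -rdivP; apply: le_trans (mul_rdiv_le z (x `|` y)); rewrite le_mul ?leUr.
Qed.

Lemma absval_le1 x : absval x <= 1.
Proof. exact: leIr. Qed.

Lemma absval_le x : absval x <= x.
Proof. by rewrite /absval -meetA leIl. Qed.

Lemma absval_id x : x <= 1 -> absval x = x.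
Proof.
move=> x1; rewrite /absval -meetA; apply/meet_idPl.
by rewrite lexI x1 andbT -rdivP mul_le1.
Qed.

End Basics.

(** * The conjugation laws in chains and varieties, and their consequences *)

Section Equations.
Context {d : Order.disp_t}.
Implicit Types L M : residuatedLatticeType d.

(** The join is one of [x], [y], so one of the two residuals is above [1], and so its conjugate is
    [1]. *)
Lemma chain_left_conj_law L : linearly_ordered L -> left_conj_law L.
Proof.
move=> Ltot x y u v; apply/le_anti; rewrite leUx lconj_le1 rconj_le1 /=.
case/orP: (Ltot x y) => [xy|yx].
  by rewrite (join_idPr xy) [X in _ `|` X]rconj_eq1 ?one_le_ldiv // leUr.
by rewrite (join_idPl yx) lconj_eq1 ?one_le_ldiv // leUl.
Qed.

Lemma morph_lconj L M (f : L -> M) : rl_morphism f ->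
  {morph f : u x / lconj u x}.
Proof. by case=> f1 fM fl fr fU fI u x; rewrite /lconj fI fl fM f1. Qed.

Lemma morph_rconj L M (f : L -> M) : rl_morphism f ->
  {morph f : u x / rconj u x}.
Proof. by case=> f1 fM fl fr fU fI u x; rewrite /rconj fI fr fM f1. Qed.

Lemma variety_left_conj_law : variety (@left_conj_law d).
Proof.
split.
- move=> L M f hf finj LL x y u v; apply: finj.
  have [f1 _ fl _ fU _] := hf.
  by rewrite fU morph_lconj // morph_rconj // !fl fU LL f1.
- move=> L M f hf fsurj LL x y u v.
  have [[x' <-] [y' <-]] := (fsurj x, fsurj y).
  have [[u' <-] [v' <-]] := (fsurj u, fsurj v).
  have [f1 _ fl _ fU _] := hf.
  by rewrite -fU -!fl -morph_lconj // -morph_rconj // -fU LL f1.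
- move=> I A HA x y u v; apply: functional_extensionality_dep => i.
  exact: (HA i (x i) (y i) (u i) (v i)).
Qed.

(** Conjugation by [1] only takes the meet with [1], and [\] is antitone in its first argument, so
    both terms of the law lie below those of prelinearity. *)
Lemma left_conj_law_prelinear L : left_conj_law L -> left_prelinear L.
Proof.
move=> LL x y; apply/le_anti; rewrite leUx !leIr /=.
rewrite -[leLHS](LL x y 1 1) lconj1 rconj1 joinC.
apply: leU2; apply: leI2 => //; last exact: ldivU_le.
by rewrite joinC ldivU_le.
Qed.

Lemma right_conj_law_prelinear L : right_conj_law L -> right_prelinear L.
Proof.
move=> LL x y; apply/le_anti; rewrite leUx !leIr /=.
rewrite -[leLHS](LL x y 1 1) lconj1 rconj1 joinC.
apply: leU2; apply: leI2 => //; last exact: rdivU_le.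
by rewrite joinC rdivU_le.
Qed.

Lemma left_conj_law_quasi L : left_conj_law L -> conj_quasi_law L.
Proof. by move=> LL x y u v xy1; rewrite -(LL x y u v) xy1 !ldiv1x. Qed.

Lemma right_conj_law_quasi L : right_conj_law L -> conj_quasi_law L.
Proof. by move=> LL x y u v xy1; rewrite -(LL x y u v) xy1 !rdivx1. Qed.

(** The quasi-identity is used with [absval a] conjugated by [u] and [absval x] by [1]. By
    monotonicity [absval a] may be replaced by [a], and a conjugate, being at most [1], is its own
    absolute value. *)
Lemma quasi_polars_normal L : conj_quasi_law L -> polars_normal L.
Proof.
move=> Q X _ a u aX; split=> x Xx; apply/le_anti.
  rewrite leUx !absval_le1 /= (absval_id (lconj_le1 _ _)).
  rewrite -[leLHS](Q _ _ u 1 (aX x Xx)) rconj1.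
  by rewrite leU2 ?lconj_mono ?absval_le ?leIl.
rewrite leUx !absval_le1 /= (absval_id (rconj_le1 _ _)) joinC.
have := aX x Xx; rewrite joinC => /(fun e => Q _ _ 1 u e) <-.
by rewrite lconj1 leU2 ?rconj_mono ?absval_le ?leIl.
Qed.

End Equations.

(** * Filters, prime filters and minimal prime filters of the negative cone *)

Section Filters.
Context {d : Order.disp_t} {L : residuatedLatticeType d}.
Implicit Types (x y z a b c u f g : L) (F G P S A : set L).

Record neg_filter F : Prop := NegFilter {
  nfilter1 : F 1;
  nfilterM : forall x y, F x -> F y -> F (x * y);
  nfilter_up : forall x y, F x -> x <= y -> y <= 1 -> F y;
  nfilter_le1 : forall x, F x -> x <= 1
}.

Record normal_filter F : Prop := NormalFilter {
  nfilter_neg :> neg_filter F;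
  nfilter_normal : normal F
}.

Definition prime_filter F : Prop := neg_filter F /\
  forall x y, x <= 1 -> y <= 1 -> F (x `|` y) -> F x \/ F y.

Definition minimal_prime_filter F : Prop := prime_filter F /\
  forall G, prime_filter G -> (G `<=` F)%classic -> (F `<=` G)%classic.

Definition join_closed S : Prop := forall x y, S x -> S y -> S (x `|` y).

(* The relative pseudocomplement of [A] in the lattice of filters over [F]. *)
Definition residual F A : set L :=
  [set x | x <= 1 /\ forall a, A a -> F (x `|` a)].

Lemma neg_filter_one : neg_filter [set 1].
Proof.
split=> //= [x y -> ->|x y -> x1 y1|x -> //]; first by rewrite mulg1.
by apply/le_anti; rewrite x1 y1.
Qed.

Lemma nfilter_bigcup (C : set (set L)) : C !=set0 -> C `<=` neg_filter ->
  total_on C subset -> neg_filter (\bigcup_(F in C) F)%classic.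
Proof.
move=> [F0 CF0] CF Ctot; split.
- by exists F0 => //; exact: nfilter1 (CF _ CF0).
- move=> x y [F CFF Fx] [G CG Gy].
  have [FG|GF] := Ctot _ _ CFF CG.
    by exists G => //; apply: nfilterM (CF _ CG) _ _ _ _ => //; apply: FG.
  by exists F => //; apply: nfilterM (CF _ CFF) _ _ _ _ => //; apply: GF.
- move=> x y [F CFF Fx] xy y1; exists F => //.
  exact: (nfilter_up (CF _ CFF) Fx).
- by move=> x [F CFF]; exact: (nfilter_le1 (CF _ CFF)).
Qed.

Section Residual.
Variables (F A : set L).
Hypotheses (hF : neg_filter F) (A1 : forall a, A a -> a <= 1).

Lemma neg_filter_residual : neg_filter (residual F A).
Proof.
split=> [|x y [x1 xA] [y1 yA]|x y [x1 xA] xy y1|x []//].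
- split=> // a Aa; rewrite (join_idPl (A1 Aa)); exact: nfilter1.
- split=> [|a Aa]; first exact: mul_le1.
  apply: (nfilter_up hF (nfilterM hF (xA a Aa) (yA a Aa))).
    by apply: mul_join_le => //; apply: A1.
  by rewrite leUx mul_le1 //= A1.
- split=> // a Aa; apply: (nfilter_up hF (xA a Aa)); first by rewrite leU2.
  by rewrite leUx y1 A1.
Qed.

Lemma subset_residual : (F `<=` residual F A)%classic.
Proof.
move=> x Fx; have x1 := nfilter_le1 hF Fx; split=> // a Aa.
by apply: (nfilter_up hF Fx); rewrite ?leUl // leUx x1 A1.
Qed.

End Residual.

Lemma residual_le1 F A x : residual F A x -> x <= 1.
Proof. by case. Qed.

(* If [x `|` y] is in a filter [P] maximal among those disjoint from [S], but
   neither [x] nor [y] is, then the filters [residual P [set y]] and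
   [residual P (residual P [set y])] properly extend [P], so they meet [S];
   the join of the two points is in both [P] and [S]. *)
Lemma prime_filter_disjoint S : join_closed S -> ~ S 1 ->
  exists P, prime_filter P /\ forall x, P x -> ~ S x.
Proof.
move=> SU S1.
have [||P [[hP PS] _ Pmax]] := @Zorn_bigcup_above L
    [set F | neg_filter F /\ forall x, F x -> ~ S x] [set 1].
- by split=> [|x ->//]; exact: neg_filter_one.
- move=> C C0 CF Ctot; split; last by move=> x [F /CF[_]]; apply.
  by apply: nfilter_bigcup => // F /CF[].
have ext A x : (forall a, A a -> a <= 1) -> residual P A x -> ~ P x ->
    exists2 s, residual P A s & S s.
  move=> A1 Ax nPx; apply: contrapT => AS; apply/nPx/(Pmax (residual P A)) => //.
    split; first exact: neg_filter_residual.
    by move=> s As Ss; apply: AS; exists s.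
  exact: subset_residual.
exists P; split=> //; split=> // x y x1 y1 Pxy; apply: contrapT.
move=> /not_orP[nPx nPy].
have Y1 a : [set y] a -> a <= 1 by move->.
have [||s Ys Ss] := ext _ x Y1; rewrite //; first by split=> // _ ->.
have [|||t YYt St] := ext (residual P [set y]) y; rewrite //.
- exact: residual_le1.
- by split=> // a [_ /(_ y erefl)]; rewrite joinC.
apply: (PS (t `|` s)); last exact: SU.
by case: YYt => _; apply.
Qed.

(** Take a maximal join-closed [S] in the negative cone containing [c] but not [1], and a prime
    filter [F] disjoint from [S]. If [G] is a prime filter inside [F], its complement in the cone is
    join-closed, omits [1] and contains [S], so equals [S]; hence no point of [F] lies outside
    [G]. *)
Lemma minimal_prime_filter_avoiding c : c <= 1 -> c <> 1 ->
  exists2 F, minimal_prime_filter F & ~ F c.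
Proof.
move=> c1 cn1.
have [||S [[SU S1 Sn1] cS Smax]] := @Zorn_bigcup_above L
    [set S | [/\ join_closed S, forall x, S x -> x <= 1 & ~ S 1]] [set c].
- by split=> [x y -> ->|x ->|/= /esym]//; rewrite /= joinxx.
- move=> C C0 CF Ctot; split.
  + move=> x y [X CX Xx] [Y CY Yy]; have [XY|YX] := Ctot _ _ CX CY.
      by exists Y => //; have [YU _ _] := CF _ CY; apply: YU => //; apply: XY.
    by exists X => //; have [XU _ _] := CF _ CX; apply: XU => //; apply: YX.
  + by move=> x [X CX]; have [_ + _] := CF _ CX; apply.
  + by case=> X CX; have [_ _] := CF _ CX.
have [F [hF FS]] := prime_filter_disjoint SU Sn1.
exists F; last by move=> Fc; apply: FS Fc (cS _ erefl).
split=> // G [hG Gpr] GF x Fx; apply: contrapT => nGx.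
apply: (FS x Fx); apply: (Smax [set y | y <= 1 /\ ~ G y]) => /=.
- split=> [y z [y1 nGy] [z1 nGz]|y []//|[_]]; last by apply; exact: nfilter1.
  split; first by rewrite leUx y1 z1.
  by case/Gpr.
- by move=> s Ss; split; [exact: S1|move=> /GF /FS].
- by split=> //; exact: nfilter_le1 hF.1 _ Fx.
Qed.

(** Otherwise the joins of [a] with elements of the cone outside [F] form a join-closed set without
    [1], and some prime filter [P] misses it. Then [P] is inside [F], so by minimality [a] is in
    [P], and so is its join with [y], a contradiction. *)
Lemma minimal_prime_filter_polar F a y : minimal_prime_filter F ->
  F a -> y <= 1 -> ~ F y -> exists x, [/\ x <= 1, ~ F x & a `|` x = 1].
Proof.
move=> [[hF Fpr] Fmin] Fa y1 nFy; apply: contrapT => nex.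
have a1 := nfilter_le1 hF Fa.
have [|[x [x1 nFx ax1]]|P [hP PS]] := @prime_filter_disjoint
    [set s | exists x, [/\ x <= 1, ~ F x & a `|` x = s]].
- move=> _ _ [x [x1 nFx <-]] [z [z1 nFz <-]]; exists (x `|` z); split.
  + by rewrite leUx x1 z1.
  + by case/Fpr.
  + by rewrite joinACA joinxx.
- by apply: nex; exists x.
have Pax x : x <= 1 -> ~ F x -> ~ P (a `|` x).
  by move=> x1 nFx /PS; apply; exists x.
have PF : (P `<=` F)%classic.
  move=> p Pp; have p1 := nfilter_le1 hP.1 Pp; apply: contrapT => nFp.
  apply: (Pax p) => //; apply: nfilter_up hP.1 _ _ Pp _ _; rewrite ?leUr //.
  by rewrite leUx a1 p1.
apply: (Pax y) => //.
apply: nfilter_up hP.1 _ _ (Fmin P hP PF a Fa) _ _; rewrite ?leUl //.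
by rewrite leUx a1 y1.
Qed.

Lemma quasi_minimal_prime_filter_normal F : conj_quasi_law L ->
  minimal_prime_filter F -> normal F.
Proof.
move=> Q Fmin a u Fa; have [[hF Fpr] _] := Fmin.
(* The whole cone contains every conjugate. Otherwise [a] has a complement [x] outside [F], and
   primeness applies to the join of [x] with the conjugate of [a], which is [1]. *)
have [Ftop|] := pselect (forall y, y <= 1 -> F y).
  by split; apply: Ftop; [exact: lconj_le1|exact: rconj_le1].
move=> /existsNP[y /not_implyP[y1 nFy]].
have [x [x1 nFx ax1]] := minimal_prime_filter_polar Fmin Fa y1 nFy.
split; apply: contrapT => nF.
- case: (Fpr (lconj u a) x) => //; first exact: lconj_le1.
  have := Q a x u 1 ax1; rewrite rconj1 (meet_idPl x1) => ->.
  exact: nfilter1.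
- case: (Fpr (rconj u a) x) => //; first exact: rconj_le1.
  have := Q x a 1 u; rewrite joinC ax1 => /(_ erefl).
  rewrite lconj1 (meet_idPl x1) joinC => ->; exact: nfilter1.
Qed.

End Filters.

(** * The quotient by a normal filter *)

Section Quotient.
Context {d : Order.disp_t} {L : residuatedLatticeType d}.
Variable F : set L.
Hypothesis hF : normal_filter F.
Implicit Types (x y z w f g : L).

(** The order of the quotient pulled back to [L]; it is boolean so that [feq] can be used with
    [eq_quot]. *)
Definition fle x y : bool := `[< exists2 f, F f & x * f <= y >].

Lemma fleP x y : reflect (exists2 f, F f & x * f <= y) (fle x y).
Proof. exact: asboolP. Qed.

(** Normality moves the left factor to the right: [x * lconj x f] is below [f * x]. *)
Lemma fle_two_sided x y f g : F f -> F g -> f * x * g <= y -> fle x y.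
Proof.
move=> Ff Fg fxg; apply/fleP; exists (lconj x f * g).
  by apply: (nfilterM hF) => //; have [] := nfilter_normal hF x Ff.
by rewrite mulgA; apply: le_trans fxg; rewrite le_mul ?mul_lconj_le.
Qed.

(** The right-handed form suits [\], this left-handed one [/]; compatibility with products uses
    both. *)
Lemma fle_leftP x y : reflect (exists2 f, F f & f * x <= y) (fle x y).
Proof.
apply: (iffP idP) => [/fleP[f Ff xf]|[f Ff fx]].
  exists (rconj x f); first by have [] := nfilter_normal hF x Ff.
  exact: le_trans (mul_rconj_le _ _) xf.
by apply: (fle_two_sided Ff (nfilter1 hF)); rewrite mulg1.
Qed.

Lemma le_fle x y : x <= y -> fle x y.
Proof.
by move=> xy; apply/fleP; exists 1; rewrite ?mulg1 //; exact: (nfilter1 hF).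
Qed.

Lemma fle_refl : reflexive fle.
Proof. by move=> x; exact: le_fle. Qed.

Lemma fle_trans : transitive fle.
Proof.
move=> y x z /fleP[f Ff xf] /fleP[g Fg yg]; apply/fleP.
exists (f * g); first exact: (nfilterM hF).
by rewrite mulgA; apply: le_trans yg; rewrite le_mul.
Qed.

Lemma fle_mul x x' y y' : fle x x' -> fle y y' -> fle (x * y) (x' * y').
Proof.
move=> /fle_leftP[f Ff fx] /fleP[g Fg yg]; apply: (fle_two_sided Ff Fg).
by rewrite mulgA -(mulgA (f * x)) le_mul.
Qed.

Lemma fle_meet z x y : fle z (x `&` y) = fle z x && fle z y.
Proof.
apply/idP/andP => [zxy|[/fleP[f Ff zf] /fleP[g Fg zg]]].
  by split; apply: fle_trans zxy (le_fle _); rewrite ?leIl ?leIr.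
(* Both factors are at most [1], so their product is a common lower bound that stays in [F]. *)
apply/fleP; exists (f * g); first exact: (nfilterM hF).
have [f1 g1] := (nfilter_le1 hF Ff, nfilter_le1 hF Fg).
rewrite lexI (le_trans _ zf) ?(le_trans _ zg) // le_mul //.
  exact: mul_ler.
exact: mul_lel.
Qed.

Lemma fle_join z x y : fle (x `|` y) z = fle x z && fle y z.
Proof.
apply/idP/andP => [xyz|[/fleP[f Ff zf] /fleP[g Fg zg]]].
  by split; apply: fle_trans (le_fle _) xyz; rewrite ?leUl ?leUr.
apply/fleP; exists (f * g); first exact: (nfilterM hF).
have [f1 g1] := (nfilter_le1 hF Ff, nfilter_le1 hF Fg).
rewrite mulUx_le (le_trans _ zf) ?(le_trans _ zg) // le_mul //.
  exact: mul_ler.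
exact: mul_lel.
Qed.

Lemma fle_ldiv x y z : fle (x * y) z = fle y (x \ z).
Proof.
have e f : (x * y * f <= z) = (y * f <= x \ z) by rewrite -mulgA ldivP.
by apply/fleP/fleP => -[f Ff xyf]; exists f; rewrite // ?e // -e.
Qed.

Lemma fle_rdiv x y z : fle (x * y) z = fle x (z / y).
Proof.
have e f : (f * (x * y) <= z) = (f * x <= (z / y)%RL) by rewrite mulgA rdivP.
by apply/fle_leftP/fle_leftP => -[f Ff fxy]; exists f; rewrite // ?e // -e.
Qed.

Definition feq x y : bool := fle x y && fle y x.

Lemma feq_refl : reflexive feq.
Proof. by move=> x; rewrite /feq fle_refl. Qed.

Lemma feq_sym : symmetric feq.
Proof. by move=> x y; rewrite /feq andbC. Qed.

Lemma feq_trans : transitive feq.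
Proof.
move=> y x z /andP[xy yx] /andP[yz zy].
by rewrite /feq (fle_trans xy yz) (fle_trans zy yx).
Qed.

Definition feq_equiv : equiv_rel L := EquivRel feq feq_refl feq_sym feq_trans.

Definition fquot : Type := {eq_quot feq_equiv}.

HB.instance Definition _ := Choice.on fquot.
HB.instance Definition _ := Quotient.on fquot.
HB.instance Definition _ := EqQuotient.on fquot.

Implicit Types p q r : fquot.

Definition fpi x : fquot := \pi_fquot x.

Definition fquot_le p q : bool := fle (repr p) (repr q).

Lemma feq_fpi x y : feq x y = (fpi x == fpi y).
Proof. exact: esym (pi_eq_quot x y). Qed.

Lemma feq_repr x : feq (repr (fpi x)) x.
Proof. by rewrite feq_fpi /fpi reprK. Qed.

Lemma fle_reprl x y : fle (repr (fpi x)) y = fle x y.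
Proof.
by have /andP[h1 h2] := feq_repr x; apply/idP/idP; apply: fle_trans.
Qed.

Lemma fle_reprr x y : fle x (repr (fpi y)) = fle x y.
Proof.
have /andP[h1 h2] := feq_repr y.
by apply/idP/idP => h; [apply: fle_trans h h1|apply: fle_trans h h2].
Qed.

Fact fquot_le_refl : reflexive fquot_le.
Proof. by move=> p; exact: fle_refl. Qed.

Fact fquot_le_anti : antisymmetric fquot_le.
Proof.
move=> p q pq; have /eqP := etrans (esym (feq_fpi (repr p) (repr q))) pq.
by rewrite /fpi !reprK.
Qed.

Fact fquot_le_trans : transitive fquot_le.
Proof. by move=> q p r; exact: fle_trans. Qed.

HB.instance Definition _ := Order.Le_isPOrder.Build d fquot
  fquot_le_refl fquot_le_anti fquot_le_trans.

Fact fquot_leE p q : (p <= q) = fle (repr p) (repr q).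
Proof. by []. Qed.

(** The operations act on chosen representatives; [fle_reprl] and [fle_reprr] make the choice
    irrelevant to the order. *)
Definition fquot_meet p q : fquot := fpi (repr p `&` repr q).
Definition fquot_join p q : fquot := fpi (repr p `|` repr q).
Definition fquot_mul p q : fquot := fpi (repr p * repr q).
Definition fquot_ldiv p q : fquot := fpi (repr p \ repr q).
Definition fquot_rdiv p q : fquot := fpi (repr p / repr q)%RL.

Fact fquot_meetP p q r : (p <= fquot_meet q r) = (p <= q) && (p <= r).
Proof. by rewrite !fquot_leE fle_reprr fle_meet. Qed.

Fact fquot_joinP p q r : (fquot_join p q <= r) = (p <= r) && (q <= r).
Proof. by rewrite !fquot_leE fle_reprl fle_join. Qed.

HB.instance Definition _ := Order.POrder_MeetJoin_isLattice.Build d fquot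
  fquot_meetP fquot_joinP.

Lemma fpi_le x y : (fpi x <= fpi y) = fle x y.
Proof. by rewrite fquot_leE fle_reprl fle_reprr. Qed.

Lemma fpi_mul x y : fquot_mul (fpi x) (fpi y) = fpi (x * y).
Proof.
by apply/le_anti; rewrite !fpi_le !fle_mul // ?fle_reprl ?fle_reprr fle_refl.
Qed.

Lemma fpiP p : exists x, fpi x = p.
Proof. by exists (repr p); exact: reprK. Qed.

Fact fquot_mulA : associative fquot_mul.
Proof.
move=> p q r; have [[[x <-] [y <-]] [z <-]] := (fpiP p, fpiP q, fpiP r).
by rewrite !fpi_mul mulgA.
Qed.

Fact fquot_mul1 : left_id (fpi 1) fquot_mul.
Proof. by move=> p; have [x <-] := fpiP p; rewrite fpi_mul mul1g. Qed.

Fact fquot_1mul : right_id (fpi 1) fquot_mul.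
Proof. by move=> p; have [x <-] := fpiP p; rewrite fpi_mul mulg1. Qed.

HB.instance Definition _ := isMonoid.Build fquot
  fquot_mulA fquot_mul1 fquot_1mul.

Fact fquot_ldivP p q r : (p * q <= r) = (q <= fquot_ldiv p r).
Proof. by rewrite !fquot_leE fle_reprr fle_reprl fle_ldiv. Qed.

Fact fquot_rdivP p q r : (p * q <= r) = (p <= fquot_rdiv r q).
Proof. by rewrite !fquot_leE fle_reprr fle_reprl fle_rdiv. Qed.

HB.instance Definition _ := LatticeMonoid_isResiduated.Build d fquot
  fquot_ldivP fquot_rdivP.

Lemma fpiM x y : fpi x * fpi y = fpi (x * y).
Proof. exact: fpi_mul. Qed.

(** Residuals and meets are characterised by what lies below them, so this reduces their
    preservation by [fpi] to the rules for [fle]. *)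
Lemma eq_of_le (p q : fquot) : (forall x, (fpi x <= p) = (fpi x <= q)) -> p = q.
Proof.
move=> h; have [[x xp] [y yq]] := (fpiP p, fpiP q); apply/le_anti.
by rewrite -{1}xp -h xp lexx -{1}yq h yq lexx.
Qed.

Lemma fpi_morphism : rl_morphism fpi.
Proof.
split=> // [x y|x y|x y|x y|x y].
- by rewrite fpiM.
- by apply: eq_of_le => z; rewrite -ldivP fpiM !fpi_le fle_ldiv.
- by apply: eq_of_le => z; rewrite -rdivP fpiM !fpi_le fle_rdiv.
- apply/le_anti; rewrite fpi_le fle_join -!fpi_le leUl leUr leUx /=.
  by rewrite !fpi_le !le_fle ?leUl ?leUr.
- by apply: eq_of_le => z; rewrite lexI !fpi_le fle_meet.
Qed.

(** By prelinearity the two truncated residuals join to [1]; primeness puts one of them in [F],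
    where it is the factor required by [fle]. *)
Lemma fquot_chain : (forall x y, x <= 1 -> y <= 1 -> F (x `|` y) -> F x \/ F y) ->
  left_prelinear L \/ right_prelinear L -> linearly_ordered fquot.
Proof.
move=> Fpr pre p q; have [[x <-] [y <-]] := (fpiP p, fpiP q).
rewrite !fpi_le; apply/orP; case: pre => /(_ x y) pre.
  have := nfilter1 hF; rewrite -pre => /Fpr; rewrite !leIr.
  by case=> // FF; [left|right]; apply/fleP;
    (eexists; first exact: FF); rewrite ldivP leIl.
have := nfilter1 hF; rewrite -pre => /Fpr; rewrite !leIr.
by case=> // FF; [left|right]; apply/fle_leftP;
  (eexists; first exact: FF); rewrite rdivP leIl.
Qed.

End Quotient.

(** * Embedding into a product of chains *)

Section Subdirect.
Context {d : Order.disp_t}.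
Implicit Types L M : residuatedLatticeType d.

(** The filter avoids the meet of [x \ y] with [1], which differs from [1] because [x] is not below
    [y]. If the images were ordered, a factor from [F] would lie below this meet and force it into
    [F]. *)
Lemma chain_quotient_separating L (x y : L) :
  left_prelinear L \/ right_prelinear L ->
  (forall F : set L, minimal_prime_filter F -> normal F) -> ~~ (x <= y) ->
  exists M (f : L -> M), [/\ rl_morphism f, forall z, exists w, f w = z,
    linearly_ordered M & ~~ (f x <= f y)].
Proof.
move=> pre nmin nxy.
have [||F Fmin nF] := @minimal_prime_filter_avoiding d L ((x \ y) `&` 1).
- exact: leIr.
- by move=> e; move: nxy; rewrite -one_le_ldiv -e leIl.
have [[hF Fpr] _] := Fmin.
exists (fquot (NormalFilter hF (nmin F Fmin))), (@fpi _ _ _ _); split.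
- exact: fpi_morphism.
- exact: fpiP.
- exact: fquot_chain.
- rewrite fpi_le; apply/fleP => -[f Ff xfy]; apply: nF.
  by apply: (nfilter_up hF Ff); rewrite ?leIr // lexI -ldivP xfy (nfilter_le1 hF).
Qed.

Lemma normal_minimal_primes_semilinear (V : residuatedLatticeType d -> Prop) :
  variety V ->
  satisfies V (@left_prelinear d) \/ satisfies V (@right_prelinear d) ->
  (forall L (F : set L), V L -> minimal_prime_filter F -> normal F) ->
  semilinear V.
Proof.
move=> HV pre nV L; split=> [VL W HW KW|gL]; last by apply: gL => // M [].
have {}pre : left_prelinear L \/ right_prelinear L.
  by case: pre => /(_ L VL); [left|right].
(* One chain quotient for each failing inequality makes the product map injective; the chains are
   images of [L], hence in [V]. *)
pose I := {xy : L * L | ~~ (xy.1 <= xy.2)}.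
have /choice[A sepA] (i : I) := chain_quotient_separating pre
  (fun F => nV L F VL) (svalP i).
have {sepA} /all_sig[f sepf] i := cid (sepA i).
pose g (x : L) : rl_prod A := fun i => f i x.
apply: (variety_sub HW (L := rl_prod A) (f := g)).
- split=> [|x y|x y|x y|x y|x y]; apply: functional_extensionality_dep => i;
    have [mf _ _ _] := sepf i.
  + exact: rl_morph1 mf.
  + exact: rl_morphM mf _ _.
  + exact: rl_morph_ldiv mf _ _.
  + exact: rl_morph_rdiv mf _ _.
  + exact: rl_morphU mf _ _.
  + exact: rl_morphI mf _ _.
- have gle x y : g x = g y -> x <= y.
    move=> gxy; case: (boolP (x <= y)) => // nxy.
    have [_ _ _ /=] := sepf (exist _ (x, y) nxy : I).
    by rewrite -/(g x _) gxy lexx.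
  by move=> x y gxy; apply/le_anti; rewrite !gle.
- apply: (variety_prod HW) => i; apply: KW; have [mf sf lin _] := sepf i.
  by split=> //; exact: (variety_img HV mf sf VL).
Qed.

End Subdirect.

(** * Convex subalgebras and filters in the cyclic case *)

Section ConvexSubalgebrasFilters.
Context {d : Order.disp_t} {L : residuatedLatticeType d}.
Hypothesis cyc : e_cyclic L.
Implicit Types (x y z f g : L) (F G H X Y : set L).

Definition neg_cone H : set L := [set x | H x /\ x <= 1].

(* Equivalently the [z] with [absval z] in [F]. *)
Definition convex_closure F : set L :=
  [set z | exists f, [/\ F f, f <= z & f * z <= 1]].

(** The form in which cyclicity is used: the bound [f * z <= 1] in [convex_closure] becomes
    two-sided. *)
Lemma cyclic_mulC_le1 x y : (x * y <= 1) = (y * x <= 1).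
Proof. by rewrite rdivP ldivP cyc. Qed.

Lemma convex_subalgebra_closure F :
  neg_filter F -> convex_subalgebra (convex_closure F).
Proof.
move=> hF.
have F1 := nfilter_le1 hF.
have FM f g : F f -> F g ->
    exists h, [/\ F h, h <= f * g, h <= g * f, h <= f & h <= g].
  move=> Ff Fg; have [f1 g1] := (F1 f Ff, F1 g Fg).
  (* This product lies below [f * g] and [g * f], so one witness serves both bounds whatever the
     order of the factors. *)
  set h := (f * g) * (g * f); have [fg gf] : h <= f * g /\ h <= g * f.
    by split; [apply: mul_lel|apply: mul_ler]; exact: mul_le1.
  exists h; split=> //; first by do !apply: (nfilterM hF).
    by apply: le_trans fg _; exact: mul_lel.
  by apply: le_trans fg _; exact: mul_ler.
split.
- by exists 1; split; rewrite ?mulg1 //; exact: nfilter1.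
- move=> x y [f [Ff fx fx1]] [g [Fg gy gy1]].
  have [h [Fh hfg hgf _ _]] := FM f g Ff Fg; exists h; split=> //.
    exact: le_trans hfg (le_mul fx gy).
  apply: (le_trans (le_mul hgf (lexx _))); rewrite mulgA -(mulgA g).
  by apply: le_trans gy1; rewrite le_mul // mul_lel.
- move=> x y [f [Ff fx fx1]] [g [Fg gy gy1]].
  have [h [Fh hfg hgf _ _]] := FM f g Ff Fg; exists h; split=> //.
    rewrite -ldivP; apply: (le_trans (le_mul (lexx _) hfg)); rewrite mulgA.
    by apply: le_trans gy; rewrite mul_ler // cyclic_mulC_le1.
  apply: (le_trans (le_mul hgf (lexx _))); rewrite -mulgA.
  apply: le_trans gy1; rewrite le_mul //.
  exact: le_trans (le_mul fx (lexx _)) (mul_ldiv_le _ _).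
- move=> x y [f [Ff fx fx1]] [g [Fg gy gy1]].
  have [h [Fh hfg hgf _ _]] := FM f g Ff Fg; exists h; split=> //.
    rewrite -rdivP; apply: (le_trans (le_mul hfg (lexx _))); rewrite -mulgA.
    by apply: le_trans fx; rewrite mul_lel.
  rewrite cyclic_mulC_le1; apply: (le_trans (le_mul (lexx _) hgf)).
  rewrite mulgA cyclic_mulC_le1; apply: le_trans fx1; rewrite le_mul //.
  exact: le_trans (le_mul (lexx _) gy) (mul_rdiv_le _ _).
- move=> x y [f [Ff fx fx1]] [g [Fg gy gy1]].
  have [h [Fh _ _ hf hg]] := FM f g Ff Fg; exists h; split=> //.
    by rewrite lexUl // (le_trans hf).
  by rewrite mulxU_le (le_trans _ fx1) ?(le_trans _ gy1) // le_mul.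
- move=> x y [f [Ff fx fx1]] [g [Fg gy gy1]].
  have [h [Fh _ _ hf hg]] := FM f g Ff Fg; exists h; split=> //.
    by rewrite lexI (le_trans hf) // (le_trans hg).
  by apply: le_trans fx1; rewrite le_mul ?leIl.
- move=> x y z [f [Ff fx fx1]] [g [Fg gz gz1]] xy yz.
  have [h [Fh _ _ hf hg]] := FM f g Ff Fg; exists h; split=> //.
    exact: le_trans hf (le_trans fx xy).
  by apply: le_trans gz1; rewrite le_mul.
Qed.

Lemma neg_filter_neg_cone H : convex_subalgebra H -> neg_filter (neg_cone H).
Proof.
move=> cH; split.
- by split; first exact: csub1.
- by move=> x y [Hx x1] [Hy y1]; split; [apply: csubM|apply: mul_le1].
- move=> x y [Hx x1] xy y1; split=> //.
  exact: (csub_convex cH Hx (csub1 cH)).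
- by move=> x [].
Qed.

Lemma csub_absval H x : convex_subalgebra H -> H x -> H (absval x).
Proof.
move=> cH Hx; have H1 := csub1 cH.
by apply: csubI => //; apply: csubI => //; apply: csub_rdiv.
Qed.

Lemma neg_cone_absval H x : convex_subalgebra H -> H x -> neg_cone H (absval x).
Proof. by move=> cH Hx; split; [exact: csub_absval|exact: absval_le1]. Qed.

Lemma absval_mul_le1 x : absval x * x <= 1.
Proof. by rewrite rdivP (le_trans (leIl _ _)) // leIr. Qed.

(** The conditions on [f] place [z] between [f] and [f \ 1], so convexity applies; conversely
    [absval x] is a witness for [x]. *)
Lemma neg_coneK H : convex_subalgebra H -> convex_closure (neg_cone H) = H.
Proof.
move=> cH; apply/seteqP; split=> x.
  case=> f [[Hf f1] fx fx1]; apply: (csub_convex cH Hf _ fx).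
    exact: (csub_ldiv cH Hf (csub1 cH)).
  by rewrite -ldivP.
move=> Hx; exists (absval x); split; last exact: absval_mul_le1.
  exact: neg_cone_absval.
exact: absval_le.
Qed.

Lemma convex_closureK F : neg_filter F -> neg_cone (convex_closure F) = F.
Proof.
move=> hF; apply/seteqP; split=> x.
  by case=> -[f [Ff fx _]]; exact: (nfilter_up hF Ff).
move=> Fx; have x1 := nfilter_le1 hF Fx; split=> //.
by exists x; split=> //; exact: mul_le1.
Qed.

Lemma convex_closure_mono F G :
  (F `<=` G)%classic -> (convex_closure F `<=` convex_closure G)%classic.
Proof. by move=> FG x [f [Ff fx fx1]]; exists f; split=> //; exact: FG. Qed.

Lemma neg_cone_mono H X :
  (H `<=` X)%classic -> (neg_cone H `<=` neg_cone X)%classic.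
Proof. by move=> HX x [Hx x1]; split=> //; exact: HX. Qed.

Lemma absval_csub H x : convex_subalgebra H -> H (absval x) -> H x.
Proof.
move=> cH Hx; rewrite -(neg_coneK cH); exists (absval x); split.
- by split; last exact: absval_le1.
- exact: absval_le.
- exact: absval_mul_le1.
Qed.

(** Primeness of [H] is applied to the closures of [A], which contains [x], and [B], which contains
    [y]. If [z] is in both, [absval z] is in [A] and [B], so its join with itself is in the cone of
    [H]. *)
Lemma prime_neg_cone H :
  prime_convex_subalgebra H -> prime_filter (neg_cone H).
Proof.
move=> [cH Hpr]; have hF := neg_filter_neg_cone cH; split=> // x y x1 y1 Hxy.
set F := neg_cone H in hF Hxy *.
have Y1 a : [set y] a -> a <= 1 by move->.
pose A := residual F [set y]; pose B := residual F A.
have hA : neg_filter A by exact: neg_filter_residual.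
have A1 a : A a -> a <= 1 by exact: residual_le1.
have hB : neg_filter B by exact: neg_filter_residual.
have AB : (convex_closure A `&` convex_closure B `<=` H)%classic.
  move=> z [Az Bz]; apply: absval_csub => //.
  have [cA cB] := (convex_subalgebra_closure hA, convex_subalgebra_closure hB).
  have := neg_cone_absval cA Az; rewrite convex_closureK // => {}Az.
  have := neg_cone_absval cB Bz; rewrite convex_closureK // => -[_ /(_ _ Az)].
  by rewrite joinxx => -[].
case: (Hpr _ _ (convex_subalgebra_closure hA) (convex_subalgebra_closure hB) AB).
  move=> /neg_cone_mono; rewrite convex_closureK // => sA; left; apply: sA.
  by split=> // _ ->.
move=> /neg_cone_mono; rewrite convex_closureK // => sB; right; apply: sB.
by split=> // a [_ /(_ y erefl)]; rewrite joinC.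
Qed.

(** For [x] in [X] and [y] in [Y] outside the closure, the join of [absval x] and [absval y] is in
    both [X] and [Y] by convexity, hence in [F], against primeness. *)
Lemma prime_convex_closure F :
  prime_filter F -> prime_convex_subalgebra (convex_closure F).
Proof.
move=> [hF Fpr]; have cF := convex_subalgebra_closure hF; split=> // X Y cX cY XY.
apply: contrapT => /not_orP[nX nY].
have [x Xx nFx] : exists2 x, X x & ~ convex_closure F x.
  apply: contrapT => h; apply: nX => x Xx.
  by apply: contrapT => ?; apply: h; exists x.
have [y Yy nFy] : exists2 y, Y y & ~ convex_closure F y.
  apply: contrapT => h; apply: nY => y Yy.
  by apply: contrapT => ?; apply: h; exists y.
have Fcl z : F (absval z) -> convex_closure F z.
  by rewrite -{1}(convex_closureK hF) => -[+ _]; exact: absval_csub.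
have [|||Fx|Fy] := Fpr (absval x) (absval y); try exact: absval_le1.
- have xy1 : absval x `|` absval y <= 1 by rewrite leUx !absval_le1.
  rewrite -(convex_closureK hF); split=> //; apply: XY; split.
    exact: (csub_convex cX (csub_absval cX Xx) (csub1 cX) (leUl _ _)).
  exact: (csub_convex cY (csub_absval cY Yy) (csub1 cY) (leUr _ _)).
- exact/nFx/Fcl.
- exact/nFy/Fcl.
Qed.

Lemma minimal_prime_neg_cone H :
  minimal_prime H -> minimal_prime_filter (neg_cone H).
Proof.
move=> [pH Hmin]; split=> [|G pG GH]; first exact: prime_neg_cone.
rewrite -(convex_closureK pG.1); apply: neg_cone_mono; apply: Hmin.
  exact: prime_convex_closure.
by rewrite -(neg_coneK pH.1); exact: convex_closure_mono.
Qed.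

Lemma minimal_prime_convex_closure F :
  minimal_prime_filter F -> minimal_prime (convex_closure F).
Proof.
move=> [pF Fmin]; split=> [|X pX XF]; first exact: prime_convex_closure.
rewrite -(neg_coneK pX.1); apply: convex_closure_mono; apply: Fmin.
  exact: prime_neg_cone.
by rewrite -(convex_closureK pF.1); exact: neg_cone_mono.
Qed.

Lemma minimal_primes_normal_filters :
  minimal_primes_normal L -> forall F, minimal_prime_filter F -> normal F.
Proof.
move=> nL F mF x u; rewrite -{1 2 3}(convex_closureK mF.1.1) => -[Fx _].
have [Fl Fr] := nL _ (minimal_prime_convex_closure mF) x u Fx.
by split; split; rewrite ?lconj_le1 ?rconj_le1.
Qed.

(** Some [z] outside [H] has [x] in its polar. Since [H] is prime and omits [z], that polar lies
    inside [H], and by normality it contains the conjugates of [x]. *)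
Lemma principal_polars_minimal_primes :
  principal_polars_normal L -> minimal_primes_normal L.
Proof.
move=> nL H mH x u Hx; have [[cH _] _] := mH.
have mF := minimal_prime_neg_cone mH; have [[hF Fpr] _] := mF.
have [Htop|] := pselect (forall y, y <= 1 -> neg_cone H y).
  by split; [have [] := Htop _ (lconj_le1 u x)|have [] := Htop _ (rconj_le1 u x)].
move=> /existsNP[y /not_implyP[y1 nHy]].
have [z [z1 nHz xz]] :=
  minimal_prime_filter_polar mF (neg_cone_absval cH Hx) y1 nHy.
have polarH w : principal_polar z w -> H w.
  move=> /(_ z erefl); rewrite (absval_id z1) => wz; apply: absval_csub => //.
  have [|[]//|//] := Fpr _ _ (absval_le1 w) z1.
  by rewrite wz; exact: nfilter1.
have [|zl zr] := nL z x u; first by move=> _ ->; rewrite (absval_id z1).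
by split; exact: polarH.
Qed.

End ConvexSubalgebrasFilters.

Theorem theorem5p6 (d : Order.disp_t) (V : residuatedLatticeType d -> Prop)
    (HV : variety V) :
  [<-> semilinear V;
       satisfies V (@left_conj_law d) \/ satisfies V (@right_conj_law d);
       (satisfies V (@left_prelinear d) \/ satisfies V (@right_prelinear d)) /\
         satisfies V (@conj_quasi_law d)]
  /\
  (satisfies V (@e_cyclic d) ->
   satisfies V (@left_prelinear d) \/ satisfies V (@right_prelinear d) ->
   [<-> semilinear V;
        satisfies V (@left_conj_law d) \/ satisfies V (@right_conj_law d);
        (satisfies V (@left_prelinear d) \/ satisfies V (@right_prelinear d)) /\
          satisfies V (@conj_quasi_law d);
        satisfies V (@polars_normal d);
        satisfies V (@principal_polars_normal d);
        satisfies V (@minimal_primes_normal d)]).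
Proof.
(* The left law holds in chains and defines a variety, so it passes to all that chains generate. *)
have h12 : semilinear V ->
    satisfies V (@left_conj_law d) \/ satisfies V (@right_conj_law d).
  move=> sV; left=> L /sV; apply; first exact: variety_left_conj_law.
  by move=> M [_]; exact: chain_left_conj_law.
have h23 : satisfies V (@left_conj_law d) \/ satisfies V (@right_conj_law d) ->
    (satisfies V (@left_prelinear d) \/ satisfies V (@right_prelinear d)) /\
    satisfies V (@conj_quasi_law d).
  case=> h; split.
  - by left=> L /h; exact: left_conj_law_prelinear.
  - by move=> L /h; exact: left_conj_law_quasi.
  - by right=> L /h; exact: right_conj_law_prelinear.
  - by move=> L /h; exact: right_conj_law_quasi.
split=> [|cyc pre].
  (* The cycle closes through normality of minimal prime filters, obtained here from the
     quasi-identity. *)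
  tfae=> // -[pre Q]; apply: normal_minimal_primes_semilinear => // L F VL.
  exact: quasi_minimal_prime_filter_normal (Q L VL).
tfae=> //.
- by move=> [_ Q] L /Q; exact: quasi_polars_normal.
- by move=> h L VL x; apply: h => //; exists x.
- move=> h L VL; exact: principal_polars_minimal_primes (cyc L VL) (h L VL).
- move=> h; apply: normal_minimal_primes_semilinear => // L F VL.
  exact: minimal_primes_normal_filters (cyc L VL) (h L VL) F.
Qed.
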